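(* Let $C\subseteq\mathbb{R}^n$ be a convex set and $S\subseteq C$ non-empty. The generated supporting subspace $H_C(S)$ is the only element $V$ of $\mathcal{F}(C;S)$ such that $N_C^{V}(S)=\{0\}$; that is, $N_C^{H_C(S)}(S)=\{0\}$, and any $V\in\mathcal{F}(C;S)$ with $N_C^V(S)=\{0\}$ equals $H_C(S)$.
   Context: $A\pm B=\{a\pm b\mid a\in A,b\in B\}$. For $C\subseteq\mathbb{R}^n$ convex and $S\subseteq C$ non-empty, $\mathcal{F}(C;S)$ is the set of all linear subspaces $U\subseteq\mathbb{R}^n$ (called supporting subspaces of $C$ at $S$) such that (1) $S-S\subseteq U$ and (2) $C\setminus(U+S)$ is convex. The generated supporting subspace $H_C(S)$ is the (existing and unique) element of $\mathcal{F}(C;S)$ that is contained in every other element of $\mathcal{F}(C;S)$. Nested normal cone: for a linear subspace $U\subseteq\mathbb{R}^n$ with $S-S\subseteq U$, $$N_C^U(S):=\{v\in U\mid \forall c\in C\cap(U+S),\ \forall s\in S,\ \langle c-s,v\rangle\le 0\}.$$ *)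

(* Defs.v *)
From HB Require Import structures.
From mathcomp Require Import all_boot all_order all_algebra.
From mathcomp Require Import all_classical all_reals all_analysis.

Set Implicit Arguments.
Unset Strict Implicit.
Unset Printing Implicit Defensive.

Import Order.TTheory GRing.Theory Num.Theory.

Local Open Scope classical_set_scope.
Local Open Scope ring_scope.

Section Definitions.
Context {R : realType} {n : nat}.
Implicit Types (A B C S : set 'rV[R]_n) (U V : {vspace 'rV[R]_n}).

Definition sumset A B : set 'rV[R]_n := [set a + b | a in A & b in B].
Definition diffset A B : set 'rV[R]_n := [set a - b | a in A & b in B].

Definition dotprod (u v : 'rV[R]_n) : R := \sum_(i < n) u 0 i * v 0 i.

Definition convex C : Prop := @convex_set R 'rV[R]_n C.

Definition supporting_subspaces C S : set {vspace 'rV[R]_n} :=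
  [set U | diffset S S `<=` [set` U] /\
           convex (C `\` sumset [set` U] S)].

Definition is_generated_supporting_subspace C S U : Prop :=
  supporting_subspaces C S U /\
  forall V, supporting_subspaces C S V -> (U <= V)%VS.

(* The default value fullv is not used when C is convex and S is nonempty: see
   generated_supporting_subspaceP below. *)
Definition generated_supporting_subspace C S : {vspace 'rV[R]_n} :=
  xget fullv [set U | is_generated_supporting_subspace C S U].

Definition nested_normal_cone C U S : set 'rV[R]_n :=
  [set v | v \in U /\
           forall c, (C `&` sumset [set` U] S) c ->
           forall s, S s -> dotprod (c - s) v <= 0].

End Definitions.

Section GeneratedSupportingSubspace.
Context {R : realType} {n : nat}.
Implicit Types (C S : set 'rV[R]_n) (U V : {vspace 'rV[R]_n}).

Let sumsetP U S s x : S s -> diffset S S `<=` [set` U] ->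
  sumset [set` U] S x <-> x - s \in U.
Proof.
move=> Ss SU; split=> [[u /= uU [t St <-]]|xU].
  by rewrite -addrA rpredD//; apply: SU; exists t => //; exists s.
by exists (x - s) => //; exists s => //; rewrite subrK.
Qed.

Lemma supporting_subspaces_fullv C S : S !=set0 ->
  supporting_subspaces C S fullv.
Proof.
move=> [s Ss].
have SU : diffset S S `<=` [set` (fullv : {vspace 'rV[R]_n})].
  by move=> x _ /=; rewrite memvf.
split=> // x y l; rewrite inE => -[_ []].
by apply/(sumsetP _ Ss SU); rewrite memvf.
Qed.

Lemma supporting_subspaces_capv C S U V : convex C -> S !=set0 ->
  supporting_subspaces C S U -> supporting_subspaces C S V ->
  supporting_subspaces C S (U :&: V)%VS.
Proof.
move=> cC [s Ss] [SU cU] [SV cV].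
have SUV : diffset S S `<=` [set` (U :&: V)%VS].
  by move=> x Sx /=; rewrite memv_cap; apply/andP; split; [exact: SU|exact: SV].
split=> //; apply/convex_setW => x y xC yC l l0 l1.
move: xC yC; rewrite !inE => -[Cx xUV] [Cy yUV].
set p := conv l x y.
have Cp : C p by have := cC x y l; rewrite !inE; apply.
split=> // /(sumsetP _ Ss SUV); rewrite memv_cap => /andP[pU pV].
have pE : p - s = l%:num *: (x - s) + (1 - l%:num) *: (y - s).
  rewrite !scalerBr addrACA -opprD -scalerDl [l%:num + _]addrC subrK scale1r.
  by rewrite -/(unstable.onem _) /p.
have xyW (W : {vspace 'rV[R]_n}) : p - s \in W -> (x - s \in W) = (y - s \in W).
  rewrite pE => pW; apply/idP/idP => [xW|yW].
    have := memvZ (1 - l%:num)^-1 (memvB pW (memvZ l%:num xW)).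
    by rewrite [X in _ *: X]addrC addKr scalerA mulVf ?scale1r// subr_eq0 gt_eqF.
  have := memvZ l%:num^-1 (memvB pW (memvZ (1 - l%:num) yW)).
  by rewrite addrK scalerA mulVf ?scale1r// gt_eqF.
have avoid (W : {vspace 'rV[R]_n}) : diffset S S `<=` [set` W] ->
    convex (C `\` sumset [set` W] S) -> p - s \in W -> x - s \in W.
  move=> SW cW pW; apply: contrapT => xW.
  have yW : ~ y - s \in W by rewrite -xyW.
  have := cW x y l; rewrite !inE => /(_ _ _)[||_].
  - by split=> // /(sumsetP _ Ss SW).
  - by split=> // /(sumsetP _ Ss SW).
  by apply; apply/(sumsetP _ Ss SW).
apply: xUV; apply/(sumsetP _ Ss SUV).
by rewrite memv_cap !avoid.
Qed.

Lemma generated_supporting_subspaceP C S : convex C -> S !=set0 ->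
  is_generated_supporting_subspace C S (generated_supporting_subspace C S).
Proof.
move=> cC S0.
suff exH : exists U, is_generated_supporting_subspace C S U.
  exact: (xgetPex fullv exH).
have exF : exists d, `[< exists2 U, supporting_subspaces C S U & \dim U = d >].
  exists (\dim (fullv : {vspace 'rV[R]_n})); apply/asboolP.
  by exists fullv => //; exact: supporting_subspaces_fullv.
have [d /asboolP Fd minF] := ex_minnP exF; case: Fd => U FU dU.
exists U; split=> // V FV; apply/capv_idPl/eqP.
rewrite eqEdim capvSl dU minF//; apply/asboolP.
by exists (U :&: V)%VS => //; exact: supporting_subspaces_capv.
Qed.

Lemma generated_supporting_subspace_unique C S U :
  is_generated_supporting_subspace C S U ->
  generated_supporting_subspace C S = U.
Proof.
move=> HU; apply: xget_unique => // V [FV leV]; case: HU => FU leU.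
by apply/eqP; rewrite eqEsubv leV ?leU.
Qed.

End GeneratedSupportingSubspace.

(* Main.v *)
Require Import Defs.
From mathcomp Require Import all_boot all_order all_algebra.
From mathcomp Require Import all_classical all_reals all_analysis.
From mathcomp Require Import lra.

(** Over a point [s] of [S], a subspace [U] containing [S - S] is supporting
    exactly when [U + S = U + s] behaves like a face of [C]: an open segment of
    [C] that meets [U + s] has its end points in [U + s]
    ([supporting_subspaceP]).  Both halves of the theorem rest on this.

    If [v] lies in the normal cone nested in a supporting subspace [V], the
    functional [<_ - s, v>] is nonpositive on [C] inside [V + s], so the points
    where it vanishes form a face of that slice, and a face of a face is a
    face: [V] intersected with the hyperplane orthogonal to [v] is supporting
    too ([supporting_subspaces_cut]).  When [V] is the generated, that is the
    smallest, supporting subspace [H], this forces [H] to be orthogonal to [v],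
    and since [v] is in [H], [v = 0].

    Conversely let [V] be supporting and different from [H].  Then [H] is a
    proper subspace of [V], and the points of [C - s] in [V] but outside [H]
    form a convex set, because [H] is supporting.  A convex subset of [V] that
    avoids [H] is weakly separated from [H] by a nonzero vector of [V]
    orthogonal to [H] ([weak_separation]); that vector is in the normal cone
    nested in [V].  The separation holds without any closedness or interior
    assumption on the convex set: it is the one-dimensional extension step of
    the Hahn-Banach theorem, iterated over the finitely many dimensions between
    [H] and [V]. *)

Set Implicit Arguments.
Unset Strict Implicit.
Unset Printing Implicit Defensive.

Import Order.TTheory GRing.Theory Num.Theory.

Local Open Scope classical_set_scope.
Local Open Scope ring_scope.

(** * The dot product and orthogonality *)

Section DotProduct.
Context {R : realType} {n : nat}.
Implicit Types (u v w x y : 'rV[R]_n) (V H : {vspace 'rV[R]_n}).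

Lemma dotprodE u v : dotprod u v = (u *m v^T) 0 0.
Proof. by rewrite mxE; apply: eq_bigr => i _; rewrite mxE. Qed.

Lemma dotprodC u v : dotprod u v = dotprod v u.
Proof. by apply: eq_bigr => i _; rewrite mulrC. Qed.

Lemma dotprodDl x y v : dotprod (x + y) v = dotprod x v + dotprod y v.
Proof. by rewrite !dotprodE mulmxDl mxE. Qed.

Lemma dotprodZl a x v : dotprod (a *: x) v = a * dotprod x v.
Proof. by rewrite !dotprodE -scalemxAl mxE. Qed.

Lemma dotprodNl x v : dotprod (- x) v = - dotprod x v.
Proof. by rewrite -scaleN1r dotprodZl mulN1r. Qed.

Lemma dotprodDr v x y : dotprod v (x + y) = dotprod v x + dotprod v y.
Proof. by rewrite dotprodC dotprodDl !(dotprodC v). Qed.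

Lemma dotprodZr a v x : dotprod v (a *: x) = a * dotprod v x.
Proof. by rewrite dotprodC dotprodZl (dotprodC v). Qed.

Lemma dotprodNr v x : dotprod v (- x) = - dotprod v x.
Proof. by rewrite dotprodC dotprodNl (dotprodC v). Qed.

Lemma dotprod0r v : dotprod v 0 = 0.
Proof. by rewrite -(scale0r (0 : 'rV[R]_n)) dotprodZr mul0r. Qed.

Lemma dotprod_eq0 v : (dotprod v v == 0) = (v == 0).
Proof.
apply/eqP/eqP => [vv0|->]; last exact: dotprod0r.
apply/rowP => i; rewrite mxE; apply/eqP; rewrite -sqrf_eq0 expr2; apply/eqP.
move: i (erefl true); apply: psumr_eq0P => // i _; exact: sqr_ge0.
Qed.

Definition orthov v : {vspace 'rV[R]_n} := lker (linfun (mulmxr v^T)).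

Lemma mem_orthov v x : (x \in orthov v) = (dotprod x v == 0).
Proof.
rewrite memv_ker lfunE /= dotprodE; apply/eqP/eqP => [->|xv0].
  by rewrite mxE.
by apply/matrixP => i j; rewrite !ord1 xv0 mxE.
Qed.

(** Orthogonality to [H] amounts to \dim H linear equations, too few to cut
    the larger space [V] down to 0. *)
Lemma exists_orthogonal H V : (\dim H < \dim V)%N ->
  exists w, [/\ w \in V, w != 0 & forall h, h \in H -> dotprod h w = 0].
Proof.
move=> ltHV.
pose M : 'M[R]_(n, \dim H) := \matrix_(j, i) (vbasis H)`_i 0 j.
pose f := linfun (mulmxr M) : 'Hom('rV[R]_n, 'rV[R]_(\dim H)).
have kn0 : (V :&: lker f)%VS != 0%VS.
  rewrite -dimv_eq0 -lt0n; have := limg_ker_dim f V.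
  have : (\dim (f @: V) <= \dim H)%N.
    by rewrite (leq_trans (dimvS (subvf _)))// dimvf dim_matrix mul1r.
  by move=> lefH eV; rewrite -(ltn_add2r (\dim (f @: V))) eV add0n
    (leq_ltn_trans lefH).
exists (vpick (V :&: lker f)).
have := memv_pick (V :&: lker f); rewrite memv_cap => /andP[-> wf].
split=> // [|h hH]; first by rewrite vpick0.
set w := vpick _ in wf *.
have wb (i : 'I_(\dim H)) : dotprod w (vbasis H)`_i = 0.
  move: wf; rewrite memv_ker lfunE /= => /eqP/rowP/(_ i).
  by rewrite !mxE => <-; apply: eq_bigr => j _; rewrite mxE.
rewrite dotprodC (coord_vbasis hH).
apply: (big_ind (fun x => dotprod w x = 0)) => [|x y x0 y0|i _].
- exact: dotprod0r.
- by rewrite dotprodDr x0 y0 addr0.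
- by rewrite dotprodZr wb mulr0.
Qed.

Lemma dim_cap_orthov V w : w \in V -> w != 0 ->
  (\dim (V :&: orthov w) < \dim V)%N.
Proof.
move=> wV w0; rewrite ltnNge; apply: contra w0 => leV.
have /eqP : (V :&: orthov w == V)%VS by rewrite eqEdim capvSl.
move=> eV; move: wV; rewrite -eV memv_cap => /andP[_].
by rewrite mem_orthov dotprod_eq0.
Qed.

End DotProduct.

(** * Weak separation of a convex set from a subspace *)

Section Separation.
Context {R : realType} {n : nat}.
Implicit Types (D : set 'rV[R]_n) (x y w : 'rV[R]_n) (V H : {vspace 'rV[R]_n}).

(** Open-segment form of convexity, with free positive weights in place of the
    interval-typed parameter of [conv]. *)
Lemma convexP D : convex D <-> forall x y (a b : R), D x -> D y ->
  0 < a -> 0 < b -> a + b = 1 -> D (a *: x + b *: y).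
Proof.
split=> [cD x y a b Dx Dy a0 b0 ab1|cD].
  have a01 : 0 <= a <= 1 by apply/andP; split; lra.
  have := cD x y (Itv01 (ltW a0) (andP a01).2).
  rewrite !inE => /(_ Dx Dy).
  by have -> : b = 1 - a by lra.
apply/convex_setW => x y; rewrite !inE => Dx Dy l l0 l1; rewrite inE.
by apply: cD => //; rewrite /unstable.onem ?subr_gt0//; lra.
Qed.

(** A segment of [D] that joins the two open sides of the hyperplane
    orthogonal to [w] meets the hyperplane, at the barycentre where each end
    point is weighted by the distance of the other one to the hyperplane. *)
Lemma convex_cross D w x y : convex D -> D x -> D y ->
  0 < dotprod x w -> dotprod y w < 0 ->
  exists a b : R, [/\ 0 < a, 0 < b, a * dotprod x w + b * dotprod y w = 0,
    D (a *: x + b *: y) & dotprod (a *: x + b *: y) w = 0].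
Proof.
move=> /convexP cD Dx Dy xw yw.
have d0 : 0 < dotprod x w - dotprod y w by lra.
have dn0 : dotprod x w - dotprod y w != 0 by rewrite gt_eqF.
pose a := - dotprod y w / (dotprod x w - dotprod y w).
pose b := dotprod x w / (dotprod x w - dotprod y w).
have a0 : 0 < a by rewrite divr_gt0// oppr_gt0.
have b0 : 0 < b by rewrite divr_gt0.
have e : a * dotprod x w + b * dotprod y w = 0.
  by rewrite mulrAC [X in _ + X]mulrAC -mulrDl mulNr [X in - X + _]mulrC
    addNr mul0r.
exists a, b; split=> //; last by rewrite dotprodDl !dotprodZl.
by apply: cD => //; rewrite -mulrDl addrC divff.
Qed.

(** By induction on the dimension of [V].  The hyperplane of [V] orthogonal to
    some [w] still contains [H], and there a separating vector [v'] is given by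
    induction; it then extends to a separating [v' + t w].  The constraints on
    [t] are lower bounds from the points of [D] on the negative side of [w] and
    upper bounds from those on the positive side; they are compatible because
    the segment between two such points crosses the hyperplane within [D].  If
    all of [D] lies on one side, then [w] or its opposite separates. *)
Lemma weak_separation H V D : (H <= V)%VS -> H != V -> convex D ->
  (forall d, D d -> d \in V) -> (forall d, D d -> d \notin H) ->
  exists v, [/\ v \in V, v != 0, forall h, h \in H -> dotprod h v = 0 &
    forall d, D d -> dotprod d v <= 0].
Proof.
move=> HV neqHV cD DV DH.
have [m leVm] := ubnP (\dim V).
elim: m V leVm D HV neqHV cD DV DH => // m IHm V leVm D HV neqHV cD DV DH.
have ltHV : (\dim H < \dim V)%N.
  by rewrite ltnNge; apply: contra neqHV => leVH; rewrite eqEdim HV.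
have [w [wV w0 wH]] := exists_orthogonal ltHV.
have [noneg|] := pselect (forall d, D d -> 0 <= dotprod d w).
  exists (- w); split; rewrite ?rpredN ?oppr_eq0// => d dP.
    by rewrite dotprodNr wH// oppr0.
  by rewrite dotprodNr oppr_le0 noneg.
move=> /existsNP[y /not_implyP[Dy /negP]]; rewrite -ltNge => yw.
have [nopos|] := pselect (forall d, D d -> dotprod d w <= 0).
  by exists w.
move=> /existsNP[x /not_implyP[Dx /negP]]; rewrite -ltNge => xw.
pose V' := (V :&: orthov w)%VS.
pose D' := D `&` [set d | dotprod d w = 0].
have HV' : (H <= V')%VS.
  rewrite subv_cap HV; apply/subvP => h hH.
  by rewrite mem_orthov wH.
have D'V' d : D' d -> d \in V'.
  by move=> [Dd /= dw]; rewrite memv_cap DV// mem_orthov dw eqxx.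
have neqHV' : H != V'.
  apply/negP => /eqP eH.
  (* [D] meets the hyperplane, and would do so inside [H]. *)
  have [a [b [_ _ _ Dq qw]]] := convex_cross cD Dx Dy xw yw.
  by have /negP[] := DH _ Dq; rewrite eH; apply: D'V'.
have cD' : convex D'.
  apply/convexP => p q a b [Dp /= pw] [Dq /= qw] a0 b0 ab1.
  split; first by move/convexP: cD; apply.
  by rewrite /= dotprodDl !dotprodZl pw qw !mulr0 addr0.
have [||v' [v'V' v'0 v'H v'D]] := IHm V' _ D' HV' neqHV' cD' D'V'.
- by rewrite (leq_trans (dim_cap_orthov wV w0)).
- by move=> d [Dd _]; exact: DH.
move: v'V'; rewrite memv_cap mem_orthov => /andP[v'V /eqP v'w].
(* The lower bounds on [t]. *)
pose E := [set - dotprod d v' / dotprod d w |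
  d in D `&` [set d | dotprod d w < 0]].
have compat p : D p -> 0 < dotprod p w ->
    ubound E (- (dotprod p v' / dotprod p w)).
  move=> Dp pw _ [q [Dq /= qw] <-].
  have [a [b [a0 b0 ab Dr rw]]] := convex_cross cD Dp Dq pw qw.
  have := v'D _ (conj Dr rw); rewrite dotprodDl !dotprodZl.
  set u := - (dotprod p v' / dotprod p w) => le0.
  have uE : u * dotprod p w = - dotprod p v' by rewrite mulNr divfK// gt_eqF.
  have bE : b * (u * dotprod q w) = a * dotprod p v'.
    rewrite mulrCA (_ : b * _ = - (a * dotprod p w)); last by lra.
    by rewrite mulrN mulrCA uE mulrN opprK.
  by rewrite ler_ndivrMr// -(ler_pM2l b0) bE mulrN; lra.
have E0 : E !=set0 by exists (- dotprod y v' / dotprod y w), y.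
have Eub : has_ubound E.
  by exists (- (dotprod x v' / dotprod x w)); exact: compat.
pose t := sup E.
exists (v' + t *: w); split.
- by rewrite rpredD// rpredZ.
- (* The two summands are orthogonal. *)
  apply: contra v'0 => /eqP e; rewrite -dotprod_eq0; apply/eqP.
  have : dotprod v' (v' + t *: w) = 0 by rewrite e dotprod0r.
  by rewrite dotprodDr dotprodZr v'w mulr0 addr0.
- by move=> h hH; rewrite dotprodDr dotprodZr wH// v'H// mulr0 addr0.
- move=> d Dd; rewrite dotprodDr dotprodZr.
  have [dw|dw|dw] := ltgtP (dotprod d w) 0.
  + have : - dotprod d v' / dotprod d w <= t.
      by apply: ub_le_sup => //; exists d.
    by rewrite ler_ndivrMr//; lra.
  + have : t <= - (dotprod d v' / dotprod d w).
      by apply: ge_sup => //; exact: compat.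
    by rewrite -mulNr ler_pdivlMr//; lra.
  + by rewrite dw mulr0 addr0; apply: v'D.
Qed.

End Separation.

(** * Supporting subspaces as faces *)

Section SupportingSubspaces.
Context {R : realType} {n : nat}.
Implicit Types (C S : set 'rV[R]_n) (U V : {vspace 'rV[R]_n}).

Lemma mem_sumset_vspace U S s x : S s -> diffset S S `<=` [set` U] ->
  sumset [set` U] S x <-> x - s \in U.
Proof.
move=> Ss SU; split=> [[u /= uU [t St <-]]|xU].
  by rewrite -addrA rpredD//; apply: SU; exists t => //; exists s.
by exists (x - s) => //; exists s => //; rewrite subrK.
Qed.

Lemma comb_subr (a b : R) (x y s : 'rV[R]_n) : a + b = 1 ->
  a *: x + b *: y - s = a *: (x - s) + b *: (y - s).
Proof.
by move=> ab1; rewrite !scalerBr addrACA -opprD -scalerDl ab1 scale1r.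
Qed.

(** If the segment from [x] to [y] crosses [U + s] while one of its end points
    is outside, so is the other, which contradicts the convexity of the
    complement. *)
Lemma supporting_subspaceP C S U s : convex C -> S s ->
  supporting_subspaces C S U <-> diffset S S `<=` [set` U] /\
  forall x y (a b : R), C x -> C y -> 0 < a -> 0 < b -> a + b = 1 ->
    a *: x + b *: y - s \in U -> x - s \in U.
Proof.
move=> /convexP cC Ss; split=> -[SU cU]; split=> //.
  move=> x y a b Cx Cy a0 b0 ab1 pU.
  have [//|xU] := boolP (x - s \in U).
  have yU : y - s \notin U.
    apply: contra xU => yU; move: pU; rewrite comb_subr//
      rpredDr; last exact: rpredZ.
    move=> axU; have := memvZ a^-1 axU.
    by rewrite scalerA mulVf ?gt_eqF// scale1r.
  have /convexP/(_ x y a b) := cU.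
  case=> //; first by split=> // /(mem_sumset_vspace _ Ss SU); apply/negP.
    by split=> // /(mem_sumset_vspace _ Ss SU); apply/negP.
  by move=> _ []; apply/(mem_sumset_vspace _ Ss SU).
apply/convexP => x y a b [Cx xU] [Cy yU] a0 b0 ab1.
split; first exact: cC.
move=> /(mem_sumset_vspace _ Ss SU) pU; apply: xU.
by apply/(mem_sumset_vspace _ Ss SU); exact: (cU x y a b).
Qed.

(** The functional [<_, v>] is constant on [S], as the cone condition applies
    to two points of [S] in either order; hence [S - S] lies in the cut.  A
    segment meeting the cut has its end points in [V + s], where [<_ - s, v>]
    is nonpositive; as a positive combination of its two end values vanishes,
    both of them do. *)
Lemma supporting_subspaces_cut C S V v : convex C -> S `<=` C -> S !=set0 ->
  supporting_subspaces C S V -> nested_normal_cone C V S v ->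
  supporting_subspaces C S (V :&: orthov v)%VS.
Proof.
move=> cC SC [s Ss] FV [vV Nv].
have [SV faceV] := (supporting_subspaceP _ cC Ss).1 FV.
have Nle c t : C c -> c - s \in V -> S t -> dotprod (c - t) v <= 0.
  move=> Cc cV St; apply: Nv => //; split=> //.
  exact/(mem_sumset_vspace _ Ss SV).
apply/(supporting_subspaceP _ cC Ss); split.
  move=> _ [p Sp [q Sq <-]] /=.
  have pqV : p - q \in V by apply: SV; exists p => //; exists q.
  rewrite memv_cap pqV mem_orthov eq_le.
  have diffV r : S r -> r - s \in V 
    by move=> Sr; apply: SV; exists r => //; exists s.
  have := Nle q p (SC _ Sq) (diffV _ Sq) Sp.
  rewrite -opprB dotprodNl oppr_le0 => ->.
  by rewrite andbT; exact: Nle (SC _ Sp) (diffV _ Sp) Sq.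
move=> x y a b Cx Cy a0 b0 ab1; rewrite !memv_cap !mem_orthov.
move=> /andP[pV /eqP pv].
have xV : x - s \in V by exact: (faceV x y a b).
have yV : y - s \in V.
  by apply: (faceV y x b a) => //; [rewrite addrC | rewrite [_ + a *: x]addrC].
move: pv; rewrite comb_subr// (dotprodDl (a *: _)) !dotprodZl => e.
have x0 := Nle x s Cx xV Ss; have y0 := Nle y s Cy yV Ss.
have : b * dotprod (y - s) v <= 0 by rewrite pmulr_rle0.
rewrite xV eq_le x0 /= => bl; rewrite -(pmulr_rge0 _ a0); lra.
Qed.

(** [C - s] within [V] and outside [U] is convex, since [U] is supporting; a
    vector separating it from [U] is constant on [U + s], which contains [S],
    so the choice of [s] in [S] is immaterial. *)
Lemma nested_normal_cone_subspace_gt C S U V : convex C -> S !=set0 ->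
  supporting_subspaces C S U -> supporting_subspaces C S V ->
  (U <= V)%VS -> U != V ->
  exists2 v, v != 0 & nested_normal_cone C V S v.
Proof.
move=> cC [s Ss] FU [SV _] UV neqUV.
have [SU faceU] := (supporting_subspaceP _ cC Ss).1 FU.
pose D := [set d | [/\ C (d + s), d \in V & d \notin U]].
have cD : convex D.
  apply/convexP => x y a b [Cx xV xU] [Cy yV yU] a0 b0 ab1.
  have eqs : a *: (x + s) + b *: (y + s) = a *: x + b *: y + s.
    by rewrite !scalerDr addrACA -scalerDl ab1 scale1r.
  split; first by rewrite -eqs; move/convexP: cC; apply.
    by rewrite rpredD// rpredZ.
  apply: contra xU => pU; rewrite -(addrK s x).
  by apply: (faceU (x + s) (y + s) a b) => //; rewrite eqs addrK.
have [||v [vV v0 vU vD]] := weak_separation UV neqUV cD; try by move=> d [].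
exists v => //; split=> // c [Cc /(mem_sumset_vspace _ Ss SV) cV] t St.
have stU : s - t \in U by apply: SU; exists s => //; exists t.
rewrite -(subrK s c) -addrA dotprodDl (vU _ stU) addr0.
have [cU|cU] := boolP (c - s \in U); first by rewrite vU.
by apply: vD; split=> //; rewrite subrK.
Qed.

End SupportingSubspaces.

Theorem theorem6p3 (R : realType) (n : nat) (C S : set 'rV[R]_n)
    (convexC : convex C) (subSC : S `<=` C) (S_neq0 : S !=set0) :
  [/\ supporting_subspaces C S (generated_supporting_subspace C S),
      nested_normal_cone C (generated_supporting_subspace C S) S = [set 0] &
      forall V : {vspace 'rV[R]_n}, supporting_subspaces C S V ->
        nested_normal_cone C V S = [set 0] ->
        V = generated_supporting_subspace C S].
Proof.
have [FH minH] := generated_supporting_subspaceP convexC S_neq0.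
split=> //.
  apply/seteqP; split=> [v Nv|_ ->] /=.
    have /minH := supporting_subspaces_cut convexC subSC S_neq0 FH Nv.
    move=> /subvP/(_ v Nv.1); rewrite memv_cap => /andP[_].
    by rewrite mem_orthov dotprod_eq0 => /eqP.
  by split=> [|c _ s _]; rewrite ?mem0v// dotprod0r.
move=> V FV NV0; apply/eqP; apply: contraT => neqVH.
have [|v v0] := nested_normal_cone_subspace_gt convexC S_neq0 FH FV (minH _ FV).
  by rewrite eq_sym.
by rewrite NV0 /= => ve; rewrite ve eqxx in v0.
Qed.
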